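(* Let $\mu \in \mathbb{R}$ and $\sigma > 0$. Let $\mathcal{V}$ be a finite set of nodes partitioned into two non-empty disjoint classes $\mathcal{C}_0, \mathcal{C}_1$ with $\mathcal{C}_0 \cup \mathcal{C}_1 = \mathcal{V}$ and $|\mathcal{C}_0| = |\mathcal{C}_1|$. Each node $v_i$ has a scalar feature $x_i$, the features being independent with $x_i \sim \mathcal{N}(\mu, \sigma^2)$ if $v_i \in \mathcal{C}_0$ and $x_i \sim \mathcal{N}(-\mu, \sigma^2)$ if $v_i \in \mathcal{C}_1$. Let $n \geq 1$ and $0 \le n_0 \le n$ be integers, and suppose every node $v_i$ has a set of neighbors $N(v_i) \subseteq \mathcal{V}\setminus\{v_i\}$ with $|N(v_i)| = n$, of which exactly $n_0$ belong to the same class as $v_i$ and $n_1 = n - n_0$ belong to the other class. For $w \in [0,1]$ define the embedding $$z_i = (1-w)x_i + \frac{w}{n}\sum_{v_j \in N(v_i)} x_j .$$ Define $\texttt{CS}(z;n,n_0,w)$ as the probability that the Bayes-optimal classifier (with equal class priors $1/2$) that predicts the class of $v_i$ from $z_i$ predicts it correctly, i.e., one minus the Bayes error rate. Define $\texttt{LCS}(z;n,n_0,w)$ as $$\frac{\big(\mathbb{E}[z_i \mid v_i \in \mathcal{C}_0] - \mathbb{E}[z_i \mid v_i \in \mathcal{C}_1]\big)^2}{\tfrac{1}{2}\Big(\mathbb{E}\big[(z_i - \mathbb{E}[z_i\mid v_i\in\mathcal{C}_0])^2 \mid v_i \in \mathcal{C}_0\big] + \mathbb{E}\big[(z_i - \mathbb{E}[z_i\mid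 v_i\in\mathcal{C}_1])^2 \mid v_i \in \mathcal{C}_1\big]\Big)},$$ where expectations are over the random features. Let $w, w' \in [0,1]$. If $n_0 = n$, or if $w, w' \in \left[\max\!\left(\frac{n-2n_0}{2n-2n_0}, 0\right), 1\right]$, then $$\texttt{CS}(z;n,n_0,w) > \texttt{CS}(z;n,n_0,w') \iff \texttt{LCS}(z;n,n_0,w) > \texttt{LCS}(z;n,n_0,w').$$
   Context: $\texttt{CS}$ (''class separability'') and $\texttt{LCS}$ (''latent-class separability'', an extension of the Calinski–Harabasz index) are as defined in the claim; $w$ is the degree of graph convolution usage. The expectations and the Bayes classifier are taken with respect to the random node features, with the graph structure (neighbor counts $n$, $n_0$) fixed. *)

(* Defs.v *)
From HB Require Import structures.
From mathcomp Require Import all_boot all_order all_algebra.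
From mathcomp Require Import all_classical all_reals all_analysis.
Set Implicit Arguments. Unset Strict Implicit. Unset Printing Implicit Defensive.
Import Order.TTheory GRing.Theory Num.Theory.
Local Open Scope classical_set_scope.
Local Open Scope ring_scope.

Definition Pr d (T : measurableType d) (R : realType) (P : probability T R)
  (A : set T) : R := fine (P A).

(* Mutual independence of a finite family of real random variables:
   for every family of Borel sets B_i, P(forall i, X_i in B_i) = prod_i P(X_i in B_i).
   (Sub-families are covered by taking B_i = setT.) *)
Definition mutually_independent d (T : measurableType d) (R : realType)
  (P : probability T R) (V : finType) (X : V -> T -> R) : Prop :=
  forall B : V -> set R, (forall i, measurable (B i)) ->
    Pr P [set t | forall i, B i (X i t)] = \prod_(i : V) Pr P (X i @^-1` B i).

Definition embed (R : realType) (V : finType) (T : Type) (X : V -> T -> R)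
  (N : V -> {set V}) (n : nat) (w : R) (i : V) : T -> R :=
  fun t => (1 - w) * X i t + w / n%:R * \sum_(j in N i) X j t.

(* Accuracy of the classifier "predict class 1 iff z in A" on a node drawn
   uniformly at random (with |C_0| = |C_1| this gives class priors 1/2):
   (1/|V|) sum_i P(classifier output = class of v_i). *)
Definition accuracy d (T : measurableType d) (R : realType) (P : probability T R)
  (V : finType) (cls : V -> bool) (Z : V -> T -> R) (A : set R) : R :=
  #|V|%:R^-1 * \sum_(i : V) Pr P [set t | (Z i t \in A) = cls i].

(* CS: accuracy of the Bayes-optimal classifier, i.e. the supremum of the
   accuracy over all (measurable) classifiers R -> {C_0, C_1}. *)
Definition CS d (T : measurableType d) (R : realType) (P : probability T R)
  (V : finType) (cls : V -> bool) (Z : V -> T -> R) : R :=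
  sup [set accuracy P cls Z A | A in [set A : set R | measurable A]].

Definition Ex d (T : measurableType d) (R : realType) (P : probability T R)
  (f : T -> R) : R := fine ('E_P[f])%E.

(* class-conditional mean and variance of z_i (node uniform within class c) *)
Definition cmean d (T : measurableType d) (R : realType) (P : probability T R)
  (V : finType) (cls : V -> bool) (Z : V -> T -> R) (c : bool) : R :=
  #|[pred i | cls i == c]|%:R^-1 * \sum_(i | cls i == c) Ex P (Z i).

Definition cvar d (T : measurableType d) (R : realType) (P : probability T R)
  (V : finType) (cls : V -> bool) (Z : V -> T -> R) (c : bool) : R :=
  #|[pred i | cls i == c]|%:R^-1 *
    \sum_(i | cls i == c) Ex P (fun t => (Z i t - cmean P cls Z c) ^+ 2).

(* LCS (class separability, Calinski-Harabasz style); class false = C_0. *)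
Definition LCS d (T : measurableType d) (R : realType) (P : probability T R)
  (V : finType) (cls : V -> bool) (Z : V -> T -> R) : R :=
  (cmean P cls Z false - cmean P cls Z true) ^+ 2 /
  ((cvar P cls Z false + cvar P cls Z true) / 2).

(* Main.v *)
(* Each embedding z_i is a linear combination of independent Gaussians, hence
   Gaussian, with mean +a or -a according to the class and a standard deviation s
   common to all nodes. The best classifier between N(a, s^2) and N(-a, s^2) cuts
   at 0, because one density dominates the other on each side of 0; rescaling by
   s, its accuracy is a strictly increasing function of r = |a| / s, whatever the
   sign of a. The variance of N(a, s^2) being proportional to s^2, LCS is a
   positive multiple of r^2. Both comparisons therefore amount to comparing r. *)
Require Import Defs.
From HB Require Import structures.
From mathcomp Require Import all_boot all_order all_algebra.
From mathcomp Require Import all_classical all_reals all_analysis.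
From mathcomp Require Import measurable_realfun ring lra.
Import Order.TTheory GRing.Theory Num.Theory.
Local Open Scope classical_set_scope.
Local Open Scope ring_scope.
Set Implicit Arguments. Unset Strict Implicit. Unset Printing Implicit Defensive.

(** * Affine images of Gaussian laws *)

(* [pushforward] as a measure, with the measurability proof as an explicit
   argument: canonical inference leaves it unresolved. *)
Definition image_measure d d' (T : measurableType d) (T' : measurableType d')
    (R : realType) (m : {measure set T -> \bar R}) (f : T -> T')
    (mf : measurable_fun setT f) : {measure set T' -> \bar R} :=
  measure_function_pushforward__canonical__measure_function_Measure m mf.

Lemma measurable_affine (R : realType) (a b : R) :
  measurable_fun setT (fun x : R => a * x + b).
Proof. by apply: measurable_funD => //; apply: measurable_funM. Qed.

(** Lebesgue measure is the only measure giving each half-open interval its length. The pushforward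
    by the affine map, scaled by [a], does so because the preimage of an interval is an interval
    shortened by the factor [a]. *)
Lemma lebesgue_measure_affine (R : realType) (a b : R) (A : set R) :
  0 < a -> measurable A ->
  lebesgue_measure A =
    (a%:E * lebesgue_measure ((fun x : R => a * x + b)%R @^-1` A))%E.
Proof.
move=> a0 mA.
pose F := (fun x : R => a * x + b) : measurableTypeR R -> measurableTypeR R.
have mF : measurable_fun setT F := measurable_affine a b.
pose nu : {measure set (measurableTypeR R) -> \bar R} :=
  mscale (NngNum (ltW a0)) (image_measure (@lebesgue_measure R) mF).
suff -> : lebesgue_measure A = nu A by [].
apply: lebesgue_measure_unique => // X /ocitvP[->|[[u v] /= uv ->]].
  by rewrite !measure0.
rewrite /nu /mscale /= /pushforward.
have -> : F @^-1` `]u, v] = `](u - b) / a, (v - b) / a]%classic.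
  by apply/seteqP; split => x /=; rewrite !in_itv /= /F;
  rewrite ltr_pdivrMr// ler_pdivlMr// ltrBlDr lerBrDr (mulrC x).
rewrite !lebesgue_measure_itv /= !lte_fin uv ltr_pM2r ?invr_gt0//.
rewrite ltrD2r uv -!EFinD -EFinM; congr EFin; field.
by rewrite gt_eqF.
Qed.

Lemma normal_pdf_affine (R : realType) (m s a b x : R) : s != 0 -> 0 < a ->
  a * normal_pdf (a * m + b) (a * s) (a * x + b) = normal_pdf m s x.
Proof.
move=> s0 a0; have as0 : a * s != 0 by rewrite mulf_neq0// gt_eqF.
rewrite !normal_pdfE//= mulrA; congr (_ * _).
  rewrite /normal_peak exprMn -mulrA -mulrnAr sqrtrM ?sqr_ge0//.
  by rewrite sqrtr_sqr gtr0_norm// invfM mulrA divff ?mul1r ?gt_eqF.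
rewrite /normal_fun; congr expR; field.
by rewrite s0 (gt_eqF a0).
Qed.

(** Change of variables: Lebesgue measure is replaced by [a] times its own pushforward, and the
    factor [a] is then absorbed pointwise by the density. *)
Lemma normal_prob_affine (R : realType) (m s a b : R) (A : set R) :
  s != 0 -> 0 < a -> measurable A ->
  normal_prob (a * m + b) (a * s) A =
  normal_prob m s ((fun x : R => a * x + b) @^-1` A).
Proof.
move=> s0 a0 mA; rewrite /normal_prob.
pose F := (fun x : R => a * x + b) : measurableTypeR R -> measurableTypeR R.
have mF : measurable_fun setT F := measurable_affine a b.
have mp : measurable_fun [set: R] (EFin \o normal_pdf (a * m + b) (a * s)).
  by apply/measurable_EFinP; exact: measurable_normal_pdf.
have p0 x : (0 <= (normal_pdf (a * m + b) (a * s) x)%:E)%E.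
  by rewrite lee_fin normal_pdf_ge0.
have mFA : measurable (F @^-1` A) by rewrite -[X in measurable X]setTI; exact: mF.
pose nu : {measure set (measurableTypeR R) -> \bar R} :=
  mscale (NngNum (ltW a0)) (image_measure (@lebesgue_measure R) mF).
rewrite (eq_measure_integral nu); last first.
  by move=> X mX _; exact: lebesgue_measure_affine.
rewrite ge0_integral_mscale//=; last exact: measurable_funTS.
rewrite ge0_integral_pushforward//=; last exact: measurable_funTS.
rewrite -ge0_integralZl//=.
- by apply: eq_integral => x _ /=; rewrite -EFinM normal_pdf_affine.
- apply: measurable_funTS.
  exact: (measurableT_comp mp).
- by rewrite lee_fin ltW.
Qed.

(** * Convolution of Gaussian densities *)

Lemma ge0_integral_normal_prob (R : realType) (m s : R) (f : R -> \bar R) :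
  measurable_fun setT f -> (forall x, (0 <= f x)%E) ->
  (\int[normal_prob m s]_x f x =
   \int[lebesgue_measure]_x (f x * (normal_pdf m s x)%:E))%E.
Proof.
move=> mf f0; have dom := normal_prob_dominates m s.
rewrite -(Radon_Nikodym_SigmaFinite.change_of_variables dom)//.
have iRN := Radon_Nikodym_SigmaFinite.f_integrable dom.
have mp : measurable_fun [set: R] (EFin \o normal_pdf m s).
  by apply/measurable_EFinP; exact: measurable_normal_pdf.
apply: ae_eq_integral => //=.
- by apply: emeasurable_funM => //; exact: (measurable_int lebesgue_measure).
- exact: emeasurable_funM.
(* The Radon-Nikodym derivative and the Gaussian density have the same integral over every
   measurable set, hence agree almost everywhere. *)
- apply: ae_eqe_mul2l => /=; apply: integral_ae_eq => //=.
  by move=> E _ mE; rewrite -Radon_Nikodym_SigmaFinite.f_integral.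
Qed.

Lemma normal_pdf_shift (R : realType) (m s a x : R) : s != 0 ->
  normal_pdf (m + a) s (x + a) = normal_pdf m s x.
Proof.
move=> s0; rewrite !normal_pdfE//= /normal_fun; do 2 f_equal.
by rewrite opprD addrACA subrr addr0.
Qed.

(* Completing the square in [x]. *)
Lemma normal_pdf_mul (R : realType) (m1 s1 m2 s2 x y : R) :
  s1 != 0 -> s2 != 0 ->
  let S := Num.sqrt (s1 ^+ 2 + s2 ^+ 2) in
  normal_pdf m1 s1 x * normal_pdf (x + m2) s2 y =
  normal_pdf (m1 + m2) S y *
  normal_pdf ((s2 ^+ 2 * m1 + s1 ^+ 2 * (y - m2)) / S ^+ 2) (s1 * s2 / S) x.
Proof.
move=> s10 s20 S.
have q1 : 0 < s1 ^+ 2 by rewrite exprn_even_gt0.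
have q2 : 0 < s2 ^+ 2 by rewrite exprn_even_gt0.
have q : s1 ^+ 2 + s2 ^+ 2 != 0 by rewrite gt_eqF// addr_gt0.
have S2 : S ^+ 2 = s1 ^+ 2 + s2 ^+ 2 by rewrite sqr_sqrtr// ltW// addr_gt0.
have S0 : S != 0 by rewrite gt_eqF// sqrtr_gt0 addr_gt0.
have t0 : s1 * s2 / S != 0 by rewrite !mulf_neq0// invr_eq0.
have pi0 : (0 : R) <= pi by exact: pi_ge0.
have vpi t : (0 : R) <= t ^+ 2 * pi *+ 2 by rewrite mulrn_wge0// mulr_ge0// sqr_ge0.
rewrite !normal_pdfE//= mulrACA [RHS]mulrACA; congr (_ * _).
  rewrite /normal_peak -!invfM -!sqrtrM//; congr (_^-1); congr Num.sqrt.
  rewrite !exprMn exprVn S2; field; exact: q.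
rewrite /normal_fun -!expRD !exprMn exprVn S2; congr expR; field.
by rewrite s10 s20 q.
Qed.

(** Once the product is factored, the only factor depending on [x] is itself a Gaussian density, of
    total mass 1. *)
Lemma normal_pdf_conv (R : realType) (m1 s1 m2 s2 y : R) :
  s1 != 0 -> s2 != 0 ->
  (\int[lebesgue_measure]_x (normal_pdf m1 s1 x * normal_pdf (x + m2) s2 y)%:E =
  (normal_pdf (m1 + m2) (Num.sqrt (s1 ^+ 2 + s2 ^+ 2)) y)%:E)%E.
Proof.
move=> s10 s20.
under eq_integral do rewrite normal_pdf_mul// EFinM.
rewrite ge0_integralZl//=.
- by rewrite integral_normal_pdf mule1.
- by apply/measurable_EFinP; exact: measurable_normal_pdf.
- by move=> x _; rewrite lee_fin normal_pdf_ge0.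
- by rewrite lee_fin normal_pdf_ge0.
Qed.

Lemma normal_probT (R : realType) (m s : R) : normal_prob m s setT = 1%E.
Proof. exact: (@probability_setT _ _ _ (normal_prob m s)). Qed.

Lemma measurable_normal_prob_shift (R : realType) (m s : R) (A : set R) :
  measurable A ->
  measurable_fun setT
    (fun x : R => normal_prob m s ((fun y : R => x + y)%R @^-1` A)).
Proof.
move=> mA; pose D := (fun p : R * R => p.1 + p.2) @^-1` A.
have mD : measurable D.
  rewrite -[D]setTI.
  suff : measurable_fun setT (fun p : R * R => p.1 + p.2) by apply.
  by apply: measurable_funD; [exact: measurable_fst|exact: measurable_snd].
rewrite [X in measurable_fun _ X](_ : _ = normal_prob m s \o xsection D).
  exact: measurable_fun_xsection.
apply/funext => x /=; congr normal_prob.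
by apply/seteqP; split => y; rewrite /xsection/= inE.
Qed.

(** Both sides become integrals of one nonnegative function on the plane. Tonelli exchanges the
    order, and the inner integral is then the convolution of the two densities at [y]. *)
Lemma normal_prob_conv (R : realType) (m1 s1 m2 s2 : R) (A : set R) :
  s1 != 0 -> s2 != 0 -> measurable A ->
  (\int[normal_prob m1 s1]_x
     normal_prob m2 s2 ((fun y : R => x + y)%R @^-1` A) =
   normal_prob (m1 + m2) (Num.sqrt (s1 ^+ 2 + s2 ^+ 2)) A)%E.
Proof.
move=> s10 s20 mA.
pose k (p : R * R) : \bar R :=
  ((\1_A p.2 * normal_pdf m2 s2 (p.2 - p.1))%:E)%E.
pose f (p : R * R) : \bar R := ((normal_pdf m1 s1 p.1)%:E * k p)%E.
have mpdf m s : measurable_fun [set: R] (normal_pdf m s).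
  exact: measurable_normal_pdf.
have mk : measurable_fun setT k.
  apply/measurable_EFinP; apply: measurable_funM.
    by apply: measurableT_comp => //; exact: measurable_indic.
  apply: measurableT_comp => //.
  by apply: measurable_funB; [exact: measurable_snd|exact: measurable_fst].
have mf : measurable_fun setT f.
  apply: emeasurable_funM => //; apply/measurable_EFinP.
  by apply: (measurableT_comp (mpdf m1 s1)); exact: measurable_fst.
have k0 p : (0 <= k p)%E by rewrite lee_fin mulr_ge0// normal_pdf_ge0.
have f0 p : (0 <= f p)%E by rewrite mule_ge0// lee_fin normal_pdf_ge0.
have kE x : normal_prob m2 s2 ((fun y : R => x + y) @^-1` A) =
    (\int[lebesgue_measure]_y k (x, y))%E.
  (* The case of slope 1 moves the translation from the set to the mean. *)
  have /= := @normal_prob_affine R m2 s2 1 x A s20 ltr01 mA.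
  have -> : (fun y : R => 1 * y + x) = (fun y : R => x + y).
    by apply/funext => y; rewrite mul1r addrC.
  rewrite !mul1r => <-; rewrite /normal_prob integral_mkcond/=.
  apply: eq_integral => y _; rewrite patchE /k /= indicE.
  have -> : normal_pdf m2 s2 (y - x) = normal_pdf (m2 + x) s2 y.
    by rewrite -[in RHS](subrK x y) normal_pdf_shift.
  by case: ifP => _; rewrite ?mul1r ?mul0r.
rewrite ge0_integral_normal_prob//; last exact: measurable_normal_prob_shift.
transitivity (\int[lebesgue_measure]_x \int[lebesgue_measure]_y f (x, y))%E.
  apply: eq_integral => x _; rewrite kE muleC -ge0_integralZl//.
  - by apply: measurableT_comp => //; exact: measurable_pair1.
  - by rewrite lee_fin normal_pdf_ge0.
rewrite fubini_tonelli//= /normal_prob [RHS]integral_mkcond/=.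
apply: eq_integral => y _; rewrite patchE /f /k /= indicE.
case: ifP => _; last first.
  by under eq_integral do rewrite mul0r mule0; rewrite integral0.
rewrite -normal_pdf_conv//; apply: eq_integral => x _.
by rewrite mul1r -EFinM [x + m2]addrC -[in RHS](subrK x y) normal_pdf_shift.
Qed.

(** The joint law is known on rectangles only, which determine it; the law of the sum is then a
    convolution. The factor [c] allows [nu] to be a probability restricted to an event. *)
Lemma normal_law_add (R : realType) d (T : measurableType d)
    (nu : {measure set T -> \bar R}) (X Y : T -> R) (c m1 s1 m2 s2 : R) :
  measurable_fun setT X -> measurable_fun setT Y ->
  s1 != 0 -> s2 != 0 -> 0 <= c ->
  (forall A B, measurable A -> measurable B ->
    nu (X @^-1` A `&` Y @^-1` B) =
    (c%:E * normal_prob m1 s1 A * normal_prob m2 s2 B)%E) ->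
  forall A, measurable A -> nu ((fun t => X t + Y t)%R @^-1` A) =
    (c%:E * normal_prob (m1 + m2) (Num.sqrt (s1 ^+ 2 + s2 ^+ 2)) A)%E.
Proof.
move=> mX mY s10 s20 c0 nuE A mA.
pose GR := measurableTypeR R.
have mXY : measurable_fun setT (fun t => (X t : GR, Y t : GR)).
  exact: measurable_fun_pair.
pose J := image_measure nu mXY.
pose D : set (GR * GR) := (fun p : R * R => p.1 + p.2) @^-1` A.
have mD : measurable D.
  rewrite -[D]setTI.
  suff : measurable_fun setT (fun p : GR * GR => (p.1 : R) + p.2 : R) by apply.
  by apply: measurable_funD; [exact: measurable_fst|exact: measurable_snd].
pose N1 : {finite_measure set GR -> \bar R} :=
  mscale (NngNum c0) (normal_prob m1 s1).
have <- : J D = nu ((fun t => X t + Y t) @^-1` A) by [].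
(* The joint law is the product measure, and the latter computes the mass of [D] by integrating its
   sections. *)
rewrite -(@product_measure_unique _ _ _ _ _ N1 (normal_prob m2 s2) J)//.
rewrite -normal_prob_conv//.
transitivity (\int[N1]_x (normal_prob m2 s2 \o xsection D) x)%E; first by [].
rewrite ge0_integral_mscale//; last exact: measurable_fun_xsection.
congr (_ * _)%E; apply: eq_integral => x _; congr normal_prob.
by apply/seteqP; split => y; rewrite /xsection/= inE.
Qed.

(** * Sums of independent Gaussians *)

Lemma PrE (R : realType) d (T : measurableType d) (P : probability T R)
  (A : set T) : measurable A -> P A = (Pr P A)%:E.
Proof. by move=> mA; rewrite /Pr fineK// fin_num_measure. Qed.

Section sum_law.
Variables (R : realType) (d : measure_display) (T : measurableType d).
Variables (P : probability T R) (V : finType) (X : V -> T -> R) (m s : V -> R).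
Hypothesis mX : forall i, measurable_fun setT (X i).
Hypothesis indepX : mutually_independent P X.

Lemma measurable_preimage i (B : set R) : measurable B -> measurable (X i @^-1` B).
Proof. by move=> mB; rewrite -[X in measurable X]setTI; exact: mX. Qed.

Lemma measurable_cylinder (D : set V) (B : V -> set R) :
  (forall i, measurable (B i)) ->
  measurable [set t | forall i, D i -> B i (X i t)].
Proof.
move=> mB; rewrite [X in measurable X](_ : _ = \bigcap_(i in D) (X i @^-1` B i)).
  by apply: fin_bigcap_measurable => // i _; exact: measurable_preimage.
by apply/seteqP; split => t H i *; apply: H.
Qed.

(* Keeping the remaining variables in the event lets the induction add one
   summand at a time: the joint law of the new summand and the partial sum, under
   [P] restricted to a cylinder, is a multiple of a product of Gaussians. *)
Lemma normal_sum_cylinder (l : seq V) (A : set R) (B : V -> set R) :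
  l != [::] -> uniq l ->
  {in l, forall j, s j != 0} ->
  {in l, forall j (C : set R), measurable C ->
    P (X j @^-1` C) = normal_prob (m j) (s j) C} ->
  measurable A -> (forall i, measurable (B i)) ->
  P [set t | A (\sum_(j <- l) X j t) /\
             forall i, i \notin l -> B i (X i t)] =
  ((\prod_(i | i \notin l) Pr P (X i @^-1` B i))%:E *
   normal_prob (\sum_(j <- l) m j) (Num.sqrt (\sum_(j <- l) s j ^+ 2)) A)%E.
Proof.
elim: l A B => // k l IH A B _ /= /andP[kl ul] s0 lawX mA mB.
(* A constraint [C] on the new variable is stored in the family of sets at index [k], so that it is
   one more side of the cylinder. *)
pose upd (C : set R) i := if i == k then C else B i.
have mupd C : measurable C -> forall i, measurable (upd C i).
  by move=> mC i; rewrite /upd; case: ifP.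
have sk0 : s k != 0 by rewrite s0// mem_head.
have prod_upd C (Q : pred V) : Q k ->
    \prod_(i | Q i) Pr P (X i @^-1` upd C i) =
    Pr P (X k @^-1` C) * \prod_(i | Q i && (i != k)) Pr P (X i @^-1` B i).
  move=> Qk; rewrite (bigD1 k)//= /upd eqxx; congr (_ * _).
  by apply: eq_bigr => i /andP[_ /negbTE ->].
(* The induction starts at one summand, since an empty sum is constant and has no Gaussian density.
   Here the event is a pure cylinder and independence applies directly. *)
have [->|l0] := eqVneq l [::].
  rewrite !big_seq1 sqrtr_sqr.
  have -> : normal_prob (m k) `|s k| A = normal_prob (m k) (s k) A.
    rewrite /normal_prob; apply: eq_integral => x _.
    rewrite !normal_pdfE ?normr_eq0//= /normal_peak /normal_fun.
    by rewrite real_normK// num_real.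
  rewrite -lawX ?mem_head// (PrE _ (measurable_preimage _ mA)) -EFinM.
  rewrite [X in P X](_ : _ = [set t | forall i, upd A i (X i t)]); last first.
    apply/seteqP; split => t /=.
      rewrite big_seq1 => -[At Bt] i; rewrite /upd; case: eqP => [->//|/eqP ik].
      by apply: Bt; rewrite inE.
    move=> H; split; first by rewrite big_seq1; have := H k; rewrite /upd eqxx.
    by move=> i; rewrite inE => ik; have := H i; rewrite /upd (negbTE ik).
  rewrite PrE; last first.
    have := measurable_cylinder setT (mupd _ mA).
    by congr measurable; apply/seteqP; split => t H i *; apply: H.
  rewrite indepX; last exact: mupd.
  rewrite (prod_upd _ predT)// mulrC; congr ((_ * _)%:E).
  by apply: eq_bigl => i; rewrite mem_seq1.
have mS : measurable_fun setT (fun t => \sum_(j <- l) X j t).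
  by apply: measurable_sum => j; exact: mX.
set c := \prod_(i | i \notin k :: l) _.
have mE := measurable_cylinder [set i | i \notin k :: l] mB.
set E := [set t | _] in mE.
have sl : {in l, forall j, s j != 0} by move=> j jl; rewrite s0// inE jl orbT.
have c0 : 0 <= c by apply: prodr_ge0 => i _; exact: fine_ge0.
have S0 : 0 < \sum_(j <- l) s j ^+ 2.
  case: l l0 sl {kl ul IH lawX s0 mS c mE E c0} => // j l _ sl.
  rewrite big_cons ltr_pwDl//; first by rewrite exprn_even_gt0//= sl// mem_head.
  by apply: sumr_ge0 => i _; exact: sqr_ge0.
have joint C D : measurable C -> measurable D ->
    mrestr P mE (X k @^-1` C `&` (fun t => \sum_(j <- l) X j t) @^-1` D) =
    (c%:E * normal_prob (m k) (s k) C *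
     normal_prob (\sum_(j <- l) m j) (Num.sqrt (\sum_(j <- l) s j ^+ 2)) D)%E.
  move=> mC mD; rewrite /mrestr.
  (* As [k] is not in [l], the condition on [X k] joins those on the variables outside [k :: l] into
     a cylinder outside [l], to which the induction hypothesis applies. *)
  rewrite [X in P X](_ : _ = [set t | D (\sum_(j <- l) X j t) /\
             forall i, i \notin l -> upd C i (X i t)]); last first.
    apply/seteqP; split => t /=.
      move=> [[Ct Dt] Et]; split => // i il; rewrite /upd.
      by case: eqP => [->//|/eqP ik]; apply: Et; rewrite /= inE negb_or ik.
    move=> [Dt H]; split; first split => //.
      by have := H _ kl; rewrite /upd eqxx.
    move=> i /=; rewrite inE negb_or => /andP[ik il].
    by have := H _ il; rewrite /upd (negbTE ik).
  rewrite (IH _ _ l0 ul sl)//; last 2 first.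
  - by move=> j jl; apply: lawX; rewrite inE jl orbT.
  - exact: mupd.
  rewrite prod_upd//= -lawX ?mem_head// (PrE _ (measurable_preimage _ mC)).
  rewrite -EFinM mulrC; congr ((_ * _)%:E * _)%E.
  by apply: eq_bigl => i; rewrite inE negb_or andbC.
have := normal_law_add (mX k) mS sk0 _ c0 joint mA.
rewrite gt_eqF ?sqrtr_gt0// => /(_ isT); rewrite sqr_sqrtr ?(ltW S0)//.
rewrite !big_cons => <-; rewrite /mrestr; congr (P _).
by apply/seteqP; split => t /=; rewrite big_cons.
Qed.

Lemma normal_sum_law (l : seq V) (A : set R) :
  l != [::] -> uniq l ->
  {in l, forall j, s j != 0} ->
  {in l, forall j (C : set R), measurable C ->
    P (X j @^-1` C) = normal_prob (m j) (s j) C} ->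
  measurable A ->
  P ((fun t => \sum_(j <- l) X j t) @^-1` A) =
  normal_prob (\sum_(j <- l) m j) (Num.sqrt (\sum_(j <- l) s j ^+ 2)) A.
Proof.
move=> l0 ul s0 lawX mA.
have := normal_sum_cylinder l0 ul s0 lawX mA (fun=> measurableT).
rewrite big1 ?mul1e => [<-|i _].
  by congr (P _); apply/seteqP; split => t //= -[].
by rewrite preimage_setT /Pr probability_setT.
Qed.
End sum_law.

(** * Law of the embedding *)

(** Gathers own value and neighbor sum into one weighted sum over all nodes. It serves for the
    embedding, the total weight, the mean and the variance. *)
Lemma sum_neighborhood (R : realType) (V : finType) (D : {set V}) (i : V)
    (a b : R) (f : V -> R) : i \notin D ->
  \sum_j (if j == i then a else if j \in D then b else 0) * f j =
  a * f i + b * \sum_(j in D) f j.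
Proof.
move=> iD; rewrite (bigD1 i)//= eqxx; congr (_ + _).
rewrite big_distrr/= [RHS]big_mkcond/= [RHS](bigD1 i)//= (negbTE iD) add0r.
apply: eq_bigr => j /negbTE ->; by case: ifP => _; rewrite ?mul0r.
Qed.

(** Factor of [mu] in the mean of an embedded node of class 0: the [n0] neighbors of its class count
    positively, the others negatively. It can be negative. *)
Definition mean_scale (R : realType) (n n0 : nat) (w : R) : R :=
  1 - w + w / n%:R * (n0%:R - (n%:R - n0%:R)).

(** Standard deviation of an embedding in units of [sigma]: the [n] neighbor weights [w / n] have
    squares summing to [w ^+ 2 / n]. *)
Definition noise_scale (R : realType) (n : nat) (w : R) : R :=
  Num.sqrt ((1 - w) ^+ 2 + w ^+ 2 / n%:R).

Lemma noise_scale_gt0 (R : realType) n (w : R) : (1 <= n)%N ->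
  0 < noise_scale n w.
Proof.
move=> n1; rewrite sqrtr_gt0.
have [->|w1] := eqVneq w 1.
  by rewrite subrr expr0n/= add0r expr1n mul1r invr_gt0 ltr0n.
rewrite ltr_pwDl//; first by rewrite exprn_even_gt0//= subr_eq0 eq_sym.
by rewrite divr_ge0// sqr_ge0.
Qed.

Section embedding.
Variables (R : realType) (mu sigma : R) (V : finType) (cls : V -> bool).
Variables (d : measure_display) (T : measurableType d) (P : probability T R).
Variables (X : V -> T -> R) (N : V -> {set V}) (n n0 : nat).
Hypothesis sigma_gt0 : 0 < sigma.
Hypothesis mX : forall i, measurable_fun setT (X i).
Hypothesis indepX : mutually_independent P X.
Hypothesis lawX : forall i A, measurable A ->
  P (X i @^-1` A) = normal_prob (if cls i then - mu else mu) sigma A.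
Hypothesis n_gt0 : (1 <= n)%N.
Hypothesis Ni : forall i, i \notin N i.
Hypothesis cardN : forall i, #|N i| = n.
Hypothesis cardN0 : forall i, #|N i :&: [set j | cls j == cls i]| = n0.

Lemma measurable_embed w i : measurable_fun setT (embed X N n w i).
Proof.
apply: measurable_funD; apply: measurable_funM => //.
under eq_fun do rewrite -big_enum/=.
by apply: measurable_sum => j; exact: mX.
Qed.

Let mean j := if cls j then - mu else mu.

Lemma sum_mean_neighbors i :
  \sum_(j in N i) mean j = mean i * (n0%:R - (n%:R - n0%:R)).
Proof.
pose S := [set j | cls j == cls i]%SET.
rewrite (big_setID S)/= (eq_bigr (fun=> mean i)); last first.
  by move=> j; rewrite !inE => /andP[_ /eqP]; rewrite /mean => ->.
rewrite [X in _ + X](eq_bigr (fun=> - mean i)); last first.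
  move=> j; rewrite !inE => /andP[+ _]; rewrite /mean.
  by case: (cls j); case: (cls i); rewrite //= opprK.
rewrite !sumr_const -/S -[in RHS](cardN i) -[in RHS](cardsID S (N i)) -(cardN0 i).
by rewrite natrD -mulr_natr -[X in _ + X]mulr_natr -/S; ring.
Qed.

Lemma embed_law w i (A : set R) : 0 <= w <= 1 -> measurable A ->
  P (embed X N n w i @^-1` A) =
  normal_prob ((if cls i then - (mean_scale n n0 w * mu)
                else mean_scale n n0 w * mu))
    (sigma * noise_scale n w) A.
Proof.
move=> /andP[w0 w1] mA.
have n0' : (0 : R) < n%:R by rewrite ltr0n.
pose c j : R := if j == i then 1 - w else if j \in N i then w / n%:R else 0.
have c_ge0 j : 0 <= c j.
  by rewrite /c; case: ifP => _; [lra|case: ifP => // _; rewrite divr_ge0// ltW].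
pose Y j t := c j * X j t.
have mY j : measurable_fun setT (Y j) by apply: measurable_funM.
(* Nodes of weight zero are dropped, because a variable scaled by 0 has no Gaussian density; this
   occurs for neighbors at [w = 0] and for the node itself at [w = 1]. *)
pose l := [seq j <- enum V | c j != 0].
have cl j : j \in l -> 0 < c j.
  by rewrite mem_filter => /andP[cj _]; rewrite lt_neqAle eq_sym cj c_ge0.
have suml (f : V -> R) : (forall j, c j = 0 -> f j = 0) ->
    \sum_(j <- l) f j = \sum_j f j.
  move=> f0; rewrite big_filter big_enum_cond/= [RHS](bigID (fun j => c j != 0))/=.
  by rewrite [X in _ + X]big1 ?addr0// => j; rewrite negbK => /eqP /f0.
have l0 : l != [::].
  (* The weights add up to [1 - w + n * (w / n) = 1], so they cannot all vanish. *)
  have S1 : \sum_(j <- l) c j = 1.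
    rewrite suml//; have := sum_neighborhood (1 - w) (w / n%:R) (fun=> 1) (Ni i).
    under eq_bigr do rewrite mulr1.
    by move=> ->; rewrite sumr_const cardN mulr1 divfK ?gt_eqF// subrK.
  by apply/eqP => l0; move: S1; rewrite l0 big_nil => /eqP; rewrite eq_sym oner_eq0.
have indepY : mutually_independent P Y.
  move=> B mB; apply: (indepX (B := fun j => (fun x => c j * x) @^-1` B j)) => j.
  by rewrite -[X in measurable X]setTI; apply: measurable_funM.
have lawY : {in l, forall j (C : set R), measurable C ->
    P (Y j @^-1` C) = normal_prob (c j * mean j) (c j * sigma) C}.
  move=> j /cl cj C mC.
  have := normal_prob_affine (mean j) 0 (lt0r_neq0 sigma_gt0) cj mC.
  rewrite addr0 => ->; rewrite -lawX//.
    by congr (P _); apply/seteqP; split => t; rewrite /Y /= addr0.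
  by rewrite -[X in measurable X]setTI; exact: measurable_affine.
have -> : embed X N n w i = (fun t => \sum_(j <- l) Y j t).
  apply/funext => t; rewrite suml; last by move=> j cj; rewrite /Y cj mul0r.
  by rewrite /Y (sum_neighborhood _ _ (fun j => X j t) (Ni i)).
rewrite (normal_sum_law mY indepY l0 _ _ lawY)//; last 2 first.
- by rewrite filter_uniq// enum_uniq.
- by move=> j /cl cj; rewrite mulf_neq0 ?gt_eqF.
congr (normal_prob _ _ A).
  rewrite suml => [|j ->]; last by rewrite mul0r.
  rewrite (sum_neighborhood _ _ mean (Ni i)) sum_mean_neighbors /mean_scale.
  by rewrite /mean; case: (cls i); ring.
rewrite suml => [|j ->]; last by rewrite mul0r expr0n.
rewrite (eq_bigr (fun j => (if j == i then (1 - w) ^+ 2 else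
   if j \in N i then (w / n%:R) ^+ 2 else 0) * sigma ^+ 2)); last first.
  move=> j _; rewrite exprMn /c; case: ifP => // _; case: ifP => // _.
  by rewrite expr0n.
rewrite (sum_neighborhood _ _ (fun=> sigma ^+ 2) (Ni i)) sumr_const cardN.
rewrite /noise_scale -[X in _ = X * _](gtr0_norm sigma_gt0) -sqrtr_sqr -sqrtrM ?sqr_ge0//.
congr Num.sqrt; rewrite -mulr_natr; field.
by rewrite gt_eqF.
Qed.
End embedding.

(** * Bayes accuracy *)

Lemma le_Pr (R : realType) d (T : measurableType d) (P : probability T R)
  (A B : set T) : measurable A -> measurable B -> A `<=` B -> Pr P A <= Pr P B.
Proof. by move=> mA mB AB; rewrite -lee_fin -!PrE// le_measure// inE. Qed.

Lemma PrID (R : realType) d (T : measurableType d) (P : probability T R)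
  (A H : set T) : measurable A -> measurable H ->
  Pr P A = Pr P (A `&` H) + Pr P (A `&` ~` H).
Proof.
move=> mA mH; have mAH := measurableI _ _ mA mH.
have mAH' := measurableI _ _ mA (measurableC mH).
apply: EFin_inj; rewrite EFinD -!PrE// -measureU//.
  by rewrite -setIUr setUv setIT.
by rewrite setIACA setICr setI0.
Qed.

Definition normal_Pr (R : realType) (m s : R) (A : set R) : R :=
  fine (normal_prob m s A).

Lemma normal_PrE (R : realType) (m s : R) (A : set R) : measurable A ->
  normal_prob m s A = (normal_Pr m s A)%:E.
Proof. exact: (@PrE _ _ _ (normal_prob m s)). Qed.

Lemma le_normal_Pr (R : realType) (m s : R) (A B : set R) :
  measurable A -> measurable B -> A `<=` B -> normal_Pr m s A <= normal_Pr m s B.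
Proof. exact: (@le_Pr _ _ _ (normal_prob m s)). Qed.

Lemma normal_PrID (R : realType) (m s : R) (A H : set R) :
  measurable A -> measurable H ->
  normal_Pr m s A =
  normal_Pr m s (A `&` H) + normal_Pr m s (A `&` ~` H).
Proof. exact: (@PrID _ _ _ (normal_prob m s) A H). Qed.

Lemma normal_prob_itv_gt0 (R : realType) (m s a b : R) : s != 0 -> a < b ->
  (0 < normal_prob m s `]a, b])%E.
Proof.
move=> s0 ab.
(* A lower bound of the density on the interval: there [(x - m) ^+ 2] is at most the square at one
   of the endpoints, hence at most the sum of both. *)
pose c := normal_peak s *
  expR (- ((a - m) ^+ 2 + (b - m) ^+ 2) / (s ^+ 2 *+ 2)).
have c0 : 0 < c by rewrite mulr_gt0 ?normal_peak_gt0 ?expR_gt0.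
have mi : measurable (`]a, b]%classic : set (measurableTypeR R)).
  exact: measurable_itv.
apply: (@lt_le_trans _ _ (\int[lebesgue_measure]_(x in `]a, b]) c%:E)%E).
  rewrite integral_cst//= lebesgue_measure_itv/= lte_fin ab.
  by rewrite -EFinD -EFinM lte_fin mulr_gt0// subr_gt0.
apply: ge0_le_integral => //=.
- by move=> x _; rewrite lee_fin ltW.
- by apply: measurable_funTS; apply/measurable_EFinP; exact: measurable_normal_pdf.
move=> x; rewrite in_itv/= => /andP[ax xb]; rewrite lee_fin normal_pdfE//=.
rewrite ler_pM2l ?normal_peak_gt0// /normal_fun ler_expR ler_pM2r; last first.
  by rewrite invr_gt0 pmulrn_lgt0// exprn_even_gt0.
rewrite lerN2; have [xm|xm] := leP m x.
  apply: (@le_trans _ _ ((b - m) ^+ 2)); last by rewrite lerDr sqr_ge0.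
  by rewrite lerXn2r ?nnegrE; lra.
apply: (@le_trans _ _ ((a - m) ^+ 2)); last by rewrite lerDl sqr_ge0.
by rewrite -[leLHS]sqrrN -[leRHS]sqrrN lerXn2r ?nnegrE; lra.
Qed.

Lemma le_normal_prob (R : realType) (m s m' : R) (A : set R) : measurable A ->
  (forall x, A x -> normal_pdf m s x <= normal_pdf m' s x) ->
  normal_Pr m s A <= normal_Pr m' s A.
Proof.
move=> mA H; rewrite -lee_fin -!normal_PrE//; apply: ge0_le_integral; first exact: mA.
- by move=> x _; rewrite lee_fin normal_pdf_ge0.
- by apply: measurable_funTS; apply/measurable_EFinP; exact: measurable_normal_pdf.
- by apply: measurable_funTS; apply/measurable_EFinP; exact: measurable_normal_pdf.
- by move=> x Ax; rewrite lee_fin H.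
Qed.

(** The exponents compare through [(x - m) ^+ 2 - (x + m) ^+ 2 = - 4 * (m * x)]. *)
Lemma le_normal_pdfN (R : realType) (m s x : R) : s != 0 ->
  (normal_pdf m s x <= normal_pdf (- m) s x) = (0 <= - (m * x)).
Proof.
move=> s0; rewrite !normal_pdfE//= ler_pM2l ?normal_peak_gt0// /normal_fun.
rewrite ler_expR ler_pM2r; last by rewrite invr_gt0 pmulrn_lgt0// exprn_even_gt0.
by rewrite lerN2; apply/idP/idP; lra.
Qed.

Lemma lerD_swap (R : realDomainType) (a b b' c c' e : R) :
  c' <= c -> b <= b' -> a + b + (c' + e) <= a + c + (b' + e).
Proof. by move=> ? ?; lra. Qed.

(** Neyman-Pearson exchange: the pieces on which [A] and the half-line agree occur on both sides,
    and on each remaining piece the half-line picks the class with the larger density. *)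
Lemma bayes_halfline (R : realType) (m s : R) (A : set R) :
  0 <= m -> s != 0 -> measurable A ->
  normal_Pr (- m) s A + normal_Pr m s (~` A) <=
  normal_Pr (- m) s `]-oo, 0] + normal_Pr m s `]0, +oo[.
Proof.
move=> m0 s0 mA; set H := (`]-oo, 0%R]%classic : set R).
have mH : measurable H by exact: measurable_itv.
have mC (B : set R) : measurable B -> measurable (~` B) by exact: measurableC.
have HC : `]0, +oo[%classic = ~` H by rewrite /H setCitvl.
rewrite HC (normal_PrID _ _ mA mH) (normal_PrID _ _ (mC _ mA) mH) (normal_PrID _ _ mH mA).
rewrite (normal_PrID _ _ (mC _ mH) mA) ![H `&` _]setIC ![~` H `&` _]setIC.
have le1 : normal_Pr m s (~` A `&` H) <=
           normal_Pr (- m) s (~` A `&` H).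
  apply: le_normal_prob; first by apply: measurableI => //; exact: mC.
  move=> x [_]; rewrite /H /= in_itv/= => x0.
  by rewrite le_normal_pdfN// oppr_ge0 mulr_ge0_le0.
have le2 : normal_Pr (- m) s (A `&` ~` H) <=
           normal_Pr m s (A `&` ~` H).
  apply: le_normal_prob; first by apply: measurableI => //; exact: mC.
  move=> x [_]; rewrite -HC /= in_itv/= andbT => x0.
  rewrite -[X in _ <= normal_pdf X _ _]opprK le_normal_pdfN// mulNr opprK.
  by rewrite mulr_ge0// ltW.
exact: lerD_swap le1 le2.
Qed.

(** One term per class, after standardization. By symmetry of the Gaussian, this is the standard
    normal distribution function at [r]. *)
Definition bayes_accuracy (R : realType) (r : R) : R :=
  (normal_Pr 0 1 `]-oo, r] + normal_Pr 0 1 `](- r), +oo[) / 2.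

(** The first half-line gains the interval from [r] to [r'], of positive mass, while the second does
    not shrink. *)
Lemma bayes_accuracy_homo (R : realType) :
  {homo @bayes_accuracy R : r r' / r < r'}.
Proof.
move=> r r' rr'; rewrite /bayes_accuracy ltr_pM2r ?invr_gt0//.
apply: ltr_leD; last first.
  apply: le_normal_Pr; [exact: measurable_itv|exact: measurable_itv|].
  by move=> x /=; rewrite !in_itv/= !andbT; lra.
have mI x : measurable (`]-oo, x]%classic : set R) by exact: measurable_itv.
rewrite (normal_PrID _ _ (mI r') (mI r)).
rewrite (_ : _ `&` _ = `]-oo, r]%classic); last first.
  apply/seteqP; split => x /=; rewrite !in_itv/=; first by case.
  by move=> xr; split => //; apply: le_trans xr _; exact: ltW.
rewrite ltrDl (_ : _ `&` _ = `]r, r']%classic); last first.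
  apply/seteqP; split => x /=; rewrite !in_itv/=.
    by move=> [-> /negP]; rewrite -ltNge => ->.
  by move=> /andP[rx ->]; split => //; apply/negP; rewrite -ltNge.
by rewrite -lte_fin -normal_PrE; [exact: normal_prob_itv_gt0|exact: measurable_itv].
Qed.

Lemma bayes_accuracy_mono (R : realType) :
  {mono @bayes_accuracy R : r r' / r < r'}.
Proof.
apply: leW_mono; apply: le_mono; exact: bayes_accuracy_homo.
Qed.

Lemma bayes_halfline_scale (R : realType) (m s : R) : 0 < s ->
  (normal_Pr (- m) s `]-oo, 0] + normal_Pr m s `]0, +oo[) / 2 =
  bayes_accuracy (m / s).
Proof.
move=> s0; have n1 := oner_neq0 R.
have E1 : normal_Pr (- m) s `]-oo, 0] = normal_Pr 0 1 `]-oo, (m / s)].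
  congr fine; have := @normal_prob_affine R 0 1 s (- m) `]-oo, 0] n1 s0.
  rewrite mulr0 add0r mulr1 => H; apply: (etrans (H (measurable_itv _))).
  congr normal_prob; apply/seteqP; split => x /=; rewrite !in_itv/=;
  by rewrite ler_pdivlMr// mulrC subr_le0.
have E2 : normal_Pr m s `]0, +oo[ = normal_Pr 0 1 `](- (m / s)), +oo[.
  congr fine; have := @normal_prob_affine R 0 1 s m `]0, +oo[ n1 s0.
  rewrite mulr0 add0r mulr1 => H; apply: (etrans (H (measurable_itv _))).
  congr normal_prob; apply/seteqP; split => x /=; rewrite !in_itv/= !andbT;
  by rewrite -mulNr ltr_pdivrMr// -[- m]add0r ltrBlDr (mulrC x).
by rewrite E1 E2.
Qed.

Section CS_gaussian.
Variables (R : realType) (V : finType) (cls : V -> bool).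
Variables (d : measure_display) (T : measurableType d) (P : probability T R).
Variables (Z : V -> T -> R) (m s : R).
Hypothesis s_gt0 : 0 < s.
Hypothesis cls1 : exists i, cls i = true.
Hypothesis balanced :
  #|[pred i | cls i == false]| = #|[pred i | cls i == true]|.
Hypothesis lawZ : forall i A, measurable A ->
  P (Z i @^-1` A) = normal_prob (if cls i then - m else m) s A.

(** All nodes of a class have the same law, and each class makes up half of the nodes. *)
Lemma accuracy_gaussian (A : set R) : measurable A ->
  accuracy P cls Z A =
  (normal_Pr (- m) s A + normal_Pr m s (~` A)) / 2.
Proof.
move=> mA; pose k := #|[pred i | cls i == true]|.
have k0 : k%:R != 0 :> R.
  rewrite pnatr_eq0 -lt0n; apply/card_gt0P.
  by case: cls1 => i ci; exists i; rewrite inE ci.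
have cV : #|V| = (k + k)%N.
  rewrite -(cardC [pred i | cls i == true]); congr addn; rewrite /k -balanced.
  by apply: eq_card => i; rewrite !inE; case: (cls i).
have sumE c (F : V -> R) a : (forall i, cls i = c -> F i = a) ->
    \sum_(i | cls i == c) F i = a *+ k.
  move=> Fa; rewrite (eq_bigr (fun=> a)) => [|i /eqP /Fa//].
  by rewrite sumr_const /k; case: c {Fa}; rewrite // balanced.
rewrite /accuracy cV (bigID (fun i => cls i == true)) (sumE _ _ (normal_Pr (- m) s A)).
  rewrite (eq_bigl (fun i => cls i == false)); last by move=> i; case: (cls i).
  rewrite (sumE _ _ (normal_Pr m s (~` A))).
    rewrite /= -mulrnDl natrD -[(_ + _) *+ k]mulr_natr.
    move: (normal_Pr (- m) s A + _) (k%:R : R) k0 => a q q0.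
    by rewrite (_ : q + q = 2 * q); [field|ring].
  move=> i ci; rewrite ci; congr fine.
  have := lawZ i (measurableC mA); rewrite ci => H; apply: (etrans _ H); congr (P _).
  apply/seteqP; split => t /=; first by move=> /negbT; rewrite notin_setE.
  by move=> At; apply/negbTE; rewrite notin_setE.
move=> i ci; rewrite ci; congr fine.
have := lawZ i mA; rewrite ci => H; apply: (etrans _ H); congr (P _).
by apply/seteqP; split => t /= => [/set_mem|/mem_set].
Qed.

Lemma CS_gaussian : CS P cls Z = bayes_accuracy (`|m| / s).
Proof.
rewrite -bayes_halfline_scale//; set v := (X in _ = X).
have s0 : s != 0 by rewrite gt_eqF.
have mI : measurable (`]-oo, 0]%classic : set R) by exact: measurable_itv.
pose F := [set accuracy P cls Z A | A in [set A : set R | measurable A]].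
have [ubv Fv] : ubound F v /\ F v.
  (* The supremum is attained: by the half-line if [m] is nonnegative, by its complement otherwise.
     In the second case the bound comes from [- m] and the complement of [A]. *)
  rewrite /v; have [m0|m0] := ger0P m; (split; first move=> _ [A mA <-]).
  - rewrite accuracy_gaussian// ler_pM2r ?invr_gt0//.
    exact: bayes_halfline.
  - exists `]-oo, 0]%classic => //.
    by rewrite accuracy_gaussian ?setCitvl.
  - rewrite accuracy_gaussian// ler_pM2r ?invr_gt0// addrC.
    rewrite -{2}(setCK A) -{1}(opprK m); apply: bayes_halfline => //.
      by rewrite oppr_ge0 ltW.
    exact: measurableC.
  - exists (~` `]-oo, 0]%classic); first exact: measurableC.
    rewrite accuracy_gaussian ?setCK; last exact: measurableC.
    by rewrite setCitvl opprK addrC.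
apply/eqP; rewrite eq_le; apply/andP; split.
  by apply: ge_sup => //; exists v.
by apply: ub_le_sup => //; exists v.
Qed.
End CS_gaussian.

(** * Moments *)

(** Half of the exponent absorbs the square, since [x ^+ 2 / 4 <= expR (x ^+ 2 / 4)]; the other half
    is the exponent of a Gaussian of variance 2. This bound makes the second moment finite. *)
Lemma sqr_normal_pdf_le (R : realType) (x : R) :
  x ^+ 2 * normal_pdf 0 1 x <=
  4 * normal_peak 1 / normal_peak (Num.sqrt 2) * normal_pdf 0 (Num.sqrt 2) x.
Proof.
have r2 : Num.sqrt (2 : R) != 0 by rewrite gt_eqF// sqrtr_gt0.
rewrite !normal_pdfE ?oner_eq0//= mulrA divfK; last first.
  by rewrite gt_eqF// normal_peak_gt0.
rewrite mulrCA -mulrA [leRHS]mulrCA ler_pM2l ?normal_peak_gt0 ?oner_eq0//.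
rewrite /normal_fun !subr0 sqr_sqrtr// expr1n.
have -> : - x ^+ 2 / (1 *+ 2) = - x ^+ 2 / (2 *+ 2) + - (x ^+ 2 / 4) by field.
rewrite expRD expRN mulrCA [4 * _]mulrC ler_pM2l ?expR_gt0//.
rewrite ler_pdivrMr ?expR_gt0//.
have := expR_ge1Dx (x ^+ 2 / 4); lra.
Qed.

Lemma integrable_sqr_normal (R : realType) :
  (@normal_prob R 0 1).-integrable setT (fun x : R => (x ^+ 2)%:E).
Proof.
have mp s : measurable_fun [set: R] (EFin \o normal_pdf 0 s).
  by apply/measurable_EFinP; exact: measurable_normal_pdf.
have mx : measurable_fun [set: R] (fun x : R => (x ^+ 2)%:E).
  by apply/measurable_EFinP; exact: measurable_funX.
set C : R := 4 * normal_peak 1 / normal_peak (Num.sqrt 2).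
have C0 : 0 <= C by rewrite divr_ge0// ?mulr_ge0// normal_peak_ge0.
apply/integrableP; split; first exact: mx.
under eq_integral do rewrite /= ger0_norm ?sqr_ge0//.
rewrite ge0_integral_normal_prob//; last by move=> x; rewrite lee_fin sqr_ge0.
apply: (@le_lt_trans _ _
  (\int[lebesgue_measure]_x (C%:E * (normal_pdf 0 (Num.sqrt 2) x)%:E))%E).
  apply: ge0_le_integral => //=.
  - by move=> x _; rewrite mule_ge0// lee_fin ?sqr_ge0// normal_pdf_ge0.
  - exact: (emeasurable_funM mx (mp _)).
  - by apply: emeasurable_funM => //; exact: mp.
  - by move=> x _; rewrite -!EFinM lee_fin sqr_normal_pdf_le.
rewrite ge0_integralZl//=.
- by rewrite integral_normal_pdf mule1 ltry.
- exact: mp.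
- by move=> x _; rewrite lee_fin normal_pdf_ge0.
Qed.

(** Domination by [1 + x ^+ 2]. *)
Lemma integrable_id_normal (R : realType) :
  (@normal_prob R 0 1).-integrable setT (fun x : R => x%:E).
Proof.
have i1 : (@normal_prob R 0 1).-integrable setT (fun x : R => (1 + x ^+ 2)%:E).
  have := integrableD measurableT
    (finite_measure_integrable_cst (@normal_prob R 0 1) 1 measurableT)
    (@integrable_sqr_normal R).
  by apply: eq_integrable.
apply: le_integrable i1 => //; first exact: EFin_measurable.
move=> x _ /=; rewrite lee_fin [leRHS]ger0_norm ?addr_ge0 ?sqr_ge0//.
rewrite ler_norml; nra.
Qed.

Section normal_law_integral.
Variables (R : realType) (d : measure_display) (T : measurableType d).
Variables (P : probability T R) (Z : T -> R) (m s : R).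
Hypothesis s_gt0 : 0 < s.
Hypothesis mZ : measurable_fun setT Z.
Hypothesis lawZ : forall A, measurable A -> P (Z @^-1` A) = normal_prob m s A.

Let GR := measurableTypeR R.
Let aff : GR -> GR := fun x : R => s * x + m.
Let maff : measurable_fun setT aff := measurable_affine s m.
Let mZ' : measurable_fun setT (Z : T -> GR) := mZ.

Let image_lawE (A : set GR) : measurable A ->
  image_measure P mZ' A = image_measure (normal_prob 0 1) maff A.
Proof.
move=> mA; rewrite /image_measure/= /pushforward lawZ//.
have := normal_prob_affine 0 m (oner_neq0 _) s_gt0 mA.
by rewrite mulr0 add0r mulr1.
Qed.

Lemma ge0_integral_normal_law (g : R -> \bar R) : measurable_fun setT g ->
  (forall x, (0 <= g x)%E) ->
  (\int[P]_t g (Z t) = \int[normal_prob 0 1]_x g (s * x + m)%R)%E.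
Proof.
move=> mg g0.
transitivity (\int[image_measure P mZ']_x g x)%E.
  by rewrite /image_measure ge0_integral_pushforward.
rewrite (eq_measure_integral (image_measure (normal_prob 0 1) maff)).
  by rewrite /image_measure ge0_integral_pushforward.
by move=> A mA _; exact: image_lawE.
Qed.

(** [Z] and the affine image of a standard Gaussian have the same law. Integrability is carried to
    [P] by the nonnegative case applied to the absolute value of [g]. *)
Lemma integral_normal_law (g : R -> R) : measurable_fun setT g ->
  (normal_prob 0 1).-integrable setT (fun x : R => (g (s * x + m))%:E) ->
  (\int[P]_t (g (Z t))%:E = \int[normal_prob 0 1]_x (g (s * x + m))%:E)%E.
Proof.
move=> mg ig; have mEg : measurable_fun setT (EFin \o g) by apply/measurable_EFinP.
have iP : P.-integrable setT (fun t => (g (Z t))%:E).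
  apply/integrableP; split; first exact: (measurableT_comp mEg mZ).
  rewrite (ge0_integral_normal_law (g := fun x => `|(g x)%:E|%E))//.
    by case/integrableP: ig.
  exact: measurableT_comp.
transitivity (\int[image_measure P mZ']_x (g x)%:E)%E.
  by rewrite /image_measure integral_pushforward.
rewrite (eq_measure_integral (image_measure (normal_prob 0 1) maff)).
  by rewrite /image_measure integral_pushforward.
by move=> A mA _; exact: image_lawE.
Qed.
End normal_law_integral.

(* The values 0 and 1 of [std_mean] and [std_var] are never needed: the means of
   the two classes only enter through their difference. *)
Definition std_mean (R : realType) : R :=
  fine (\int[@normal_prob R 0 1]_x x%:E)%E.

Definition std_var (R : realType) : R :=
  fine (\int[@normal_prob R 0 1]_x ((x - std_mean R) ^+ 2)%:E)%E.

(** Domination by [2 * x ^+ 2 + 2 * k ^+ 2], the difference being [(x + k) ^+ 2]. *)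
Lemma integrable_std_var (R : realType) :
  (@normal_prob R 0 1).-integrable setT (fun x : R => ((x - std_mean R) ^+ 2)%:E).
Proof.
set k := std_mean R.
have i1 : (@normal_prob R 0 1).-integrable setT
    (fun x : R => (2 * x ^+ 2 + 2 * k ^+ 2)%:E).
  have := integrableD measurableT
    (integrableZl measurableT 2 (@integrable_sqr_normal R))
    (finite_measure_integrable_cst (@normal_prob R 0 1) (2 * k ^+ 2) measurableT).
  by apply: eq_integrable.
apply: le_integrable i1 => //.
  apply/measurable_EFinP; apply: measurable_funX.
  exact: measurable_funB.
move=> x _ /=; rewrite lee_fin !ger0_norm ?sqr_ge0//; last first.
  by rewrite addr_ge0// mulr_ge0// sqr_ge0.
have := sqr_ge0 (x + k); rewrite !expr2; lra.
Qed.

Lemma std_varE (R : realType) :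
  (\int[@normal_prob R 0 1]_x ((x - std_mean R) ^+ 2)%:E)%E = (std_var R)%:E.
Proof.
rewrite /std_var fineK//; apply: integrable_fin_num => //.
exact: integrable_std_var.
Qed.

Lemma std_var_gt0 (R : realType) : 0 < std_var R.
Proof.
rewrite -lte_fin -std_varE; set k := std_mean R.
(* On this interval the squared deviation is at least 1, so its integral is at least the positive
   mass of the interval. *)
pose I : set (measurableTypeR R) := `]k + 1, k + 2]%classic.
have mi : measurable I by exact: measurable_itv.
have mf : measurable_fun setT (fun x : R => ((x - k) ^+ 2)%:E).
  apply/measurable_EFinP; apply: measurable_funX.
  exact: measurable_funB.
apply: (@lt_le_trans _ _ (\int[normal_prob 0 1%R]_(x in I) 1)%E).
  rewrite integral_cst//= mul1e; apply: normal_prob_itv_gt0.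
    exact: oner_neq0.
  by lra.
apply: (@le_trans _ _
  (\int[normal_prob 0 1%R]_(x in I) ((x - k) ^+ 2)%:E)%E).
  apply: ge0_le_integral => //=; first exact: measurable_funTS.
  by move=> x; rewrite /I/= in_itv/= lee_fin => /andP[x1 _]; nra.
by apply: ge0_subset_integral => //= x _; rewrite lee_fin sqr_ge0.
Qed.

Lemma Ex_normal_law (R : realType) d (T : measurableType d)
    (P : probability T R) (Z : T -> R) (m s : R) :
  0 < s -> measurable_fun setT Z ->
  (forall A, measurable A -> P (Z @^-1` A) = normal_prob m s A) ->
  Ex P Z = m + s * std_mean R.
Proof.
move=> s0 mZ lawZ; rewrite /Ex expectation.unlock.
have isx : (@normal_prob R 0 1).-integrable setT (fun x : R => (s * x)%:E).
  have := integrableZl measurableT s (@integrable_id_normal R).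
  by apply: eq_integrable.
have im := finite_measure_integrable_cst (@normal_prob R 0 1) m measurableT.
have ismx := integrableD measurableT isx im.
rewrite (integral_normal_law s0 mZ lawZ (g := id))//.
under eq_integral do rewrite EFinD.
rewrite integralD//= integral_cst//= normal_probT mule1.
under eq_integral do rewrite EFinM.
rewrite integralZl//=; last exact: integrable_id_normal.
rewrite addrC fineD ?fineM//.
- by apply: integrable_fin_num => //; exact: integrable_id_normal.
- rewrite fin_numM//; apply: integrable_fin_num => //; exact: integrable_id_normal.
Qed.

Lemma Ex_sqr_normal_law (R : realType) d (T : measurableType d)
    (P : probability T R) (Z : T -> R) (m s : R) :
  0 < s -> measurable_fun setT Z ->
  (forall A, measurable A -> P (Z @^-1` A) = normal_prob m s A) ->
  Ex P (fun t => (Z t - (m + s * std_mean R)) ^+ 2) = s ^+ 2 * std_var R.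
Proof.
move=> s0 mZ lawZ; rewrite /Ex expectation.unlock; set c := m + _.
have mg : measurable_fun setT (fun x : R => ((x - c) ^+ 2)%:E).
  apply/measurable_EFinP; apply: measurable_funX.
  exact: measurable_funB.
rewrite (ge0_integral_normal_law s0 mZ lawZ mg); last first.
  by move=> x; rewrite lee_fin sqr_ge0.
have E x : ((s * x + m - c) ^+ 2)%:E =
    ((s ^+ 2)%:E * ((x - std_mean R) ^+ 2)%:E)%E.
  by rewrite -EFinM -exprMn /c; congr ((_ ^+ 2)%:E); ring.
under eq_integral do rewrite E.
rewrite integralZl//=; last exact: integrable_std_var.
by rewrite std_varE.
Qed.

(** The offset [s * std_mean R] is common to both classes and cancels, leaving a gap of [2 * m]
    between the means; both variances equal [s ^+ 2 * std_var R]. *)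
Lemma LCS_gaussian (R : realType) (V : finType) (cls : V -> bool) d
    (T : measurableType d) (P : probability T R) (Z : V -> T -> R) (m s : R) :
  0 < s -> (exists i, cls i = false) -> (exists i, cls i = true) ->
  (forall i, measurable_fun setT (Z i)) ->
  (forall i A, measurable A ->
     P (Z i @^-1` A) = normal_prob (if cls i then - m else m) s A) ->
  LCS P cls Z = 4 / std_var R * (`|m| / s) ^+ 2.
Proof.
move=> s0 c0 c1 mZ lawZ.
have cne0 c : (#|[pred i | cls i == c]|%:R : R) != 0.
  rewrite pnatr_eq0 -lt0n; apply/card_gt0P.
  by case: c; [case: c1|case: c0] => i ci; exists i; rewrite inE ci.
have avg c (f : V -> R) a : (forall i, cls i = c -> f i = a) ->
    #|[pred i | cls i == c]|%:R^-1 * \sum_(i | cls i == c) f i = a.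
  move=> fa; rewrite (eq_bigr (fun=> a)) => [|i /eqP /fa//].
  by rewrite sumr_const -[a *+ _]mulr_natr mulrCA mulVf ?mulr1.
have meanE c : cmean P cls Z c = (if c then - m else m) + s * std_mean R.
  by apply: avg => i ci; rewrite (Ex_normal_law s0 (mZ i) (@lawZ i)) ci.
have varE c : cvar P cls Z c = s ^+ 2 * std_var R.
  apply: avg => i ci; rewrite meanE -(Ex_sqr_normal_law s0 (mZ i) (@lawZ i)).
  by rewrite ci.
rewrite /LCS !meanE !varE expr_div_n real_normK ?num_real//.
have := @std_var_gt0 R; move: (std_var R) => K K0; field.
by rewrite !gt_eqF// addr_gt0// mulr_gt0// exprn_gt0.
Qed.

(** * Reduction of both comparisons to the signal-to-noise ratio *)

Unset Implicit Arguments.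

Theorem theorem1 (R : realType) (mu sigma : R) (V : finType) (cls : V -> bool)
  (d : measure_display) (T : measurableType d) (P : probability T R)
  (X : V -> {RV P >-> R}) (N : V -> {set V}) (n n0 : nat) (w w' : R) :
  0 < sigma ->
  (exists i, cls i = false) -> (exists i, cls i = true) ->
  #|[pred i | cls i == false]| = #|[pred i | cls i == true]| ->
  mutually_independent P (fun i => (X i : T -> R)) ->
  (forall i A, measurable A ->
     distribution P (X i) A = normal_prob (if cls i then - mu else mu) sigma A) ->
  (1 <= n)%N -> (n0 <= n)%N ->
  (forall i, i \notin N i) ->
  (forall i, #|N i| = n) ->
  (forall i, #|N i :&: [set j | cls j == cls i]| = n0) ->
  0 <= w <= 1 -> 0 <= w' <= 1 ->
  (n0 = n \/
   (Num.max ((n%:R - 2 * n0%:R) / (2 * n%:R - 2 * n0%:R)) 0 <= w /\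
    Num.max ((n%:R - 2 * n0%:R) / (2 * n%:R - 2 * n0%:R)) 0 <= w')) ->
  (CS P cls (embed (fun i => (X i : T -> R)) N n w) >
     CS P cls (embed (fun i => (X i : T -> R)) N n w')
   <->
   LCS P cls (embed (fun i => (X i : T -> R)) N n w) >
     LCS P cls (embed (fun i => (X i : T -> R)) N n w')).
Proof.
move=> sigma0 c0 c1 bal indepX lawX n1 n0n Ni cardN cardN0 hw hw' _.
pose ratio v := `|mean_scale n n0 v * mu| / (sigma * noise_scale n v).
have mX i : measurable_fun setT (X i : T -> R) by exact: measurable_funPT.
have key v : 0 <= v <= 1 ->
    CS P cls (embed (fun i => (X i : T -> R)) N n v) =
      bayes_accuracy (ratio v) /\
    LCS P cls (embed (fun i => (X i : T -> R)) N n v) =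
      4 / std_var R * ratio v ^+ 2.
  move=> hv.
  have s0 : 0 < sigma * noise_scale n v by rewrite mulr_gt0// noise_scale_gt0.
  have law i A := @embed_law _ mu _ _ cls _ _ _ _ N n n0 sigma0 mX indepX
    lawX n1 Ni cardN cardN0 v i A hv.
  split; first exact: (CS_gaussian s0 c1 bal law).
  apply: (LCS_gaussian s0 c0 c1 _ law) => i.
  exact: (measurable_embed N n mX).
have [-> ->] := key w hw; have [-> ->] := key w' hw'.
(* Strict monotonicity removes [bayes_accuracy] on one side and the positive factor drops out on the
   other. What remains is that squaring preserves the strict order of nonnegative ratios. *)
rewrite bayes_accuracy_mono ltr_pM2l ?divr_gt0 ?std_var_gt0//.
have r0 v : 0 <= ratio v by rewrite divr_ge0// mulr_ge0 ?(ltW sigma0)// sqrtr_ge0.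
by rewrite ltr_pXn2r ?nnegrE ?r0.
Qed.
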